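(* Let $\mathcal X_1,\mathcal X_2,\mathcal X_3$ be real Banach spaces, $X_1\subset\mathcal X_1$ and $X_2\subset\mathcal X_2$ open, and let $M_1\colon X_1\to\mathcal X_2$ and $M_2\colon X_2\to\mathcal X_3$ be mappings with $M_1(X_1)\subset X_2$. Let $x_1\in X_1$ and $x_2:=M_1(x_1)$. Suppose that for $j\in\{1,2\}$ the mapping $M_j$ is $s_j$-Gevrey at $x_j$ for some real $s_j\ge1$, i.e. there are an open neighbourhood $N_j\subset X_j$ of $x_j$, on which $M_j$ is infinitely Fréchet differentiable, and constants $\mu_j,\nu_j\in\mathbb R_{\ge0}$ such that $$\forall n\in\mathbb N^*:\quad \sup_{x\in N_j}\|\mathrm D^nM_j(x)\|_{\mathcal B^n(\mathcal X_j;\mathcal X_{j+1})}\le (n!)^{s_j}\mu_j\nu_j^n .$$ Then $M:=M_2\circ M_1\colon X_1\to\mathcal X_3$ is $s$-Gevrey at $x_1$ for $s:=\max\{s_1,s_2\}$. Specifically, for $N:=N_1\cap M_1^{-1}(N_2)$ and $$\mu=\mu_2\,\frac{\nu_2\mu_1}{\nu_2\mu_1+1},\qquad \nu=(\nu_2\mu_1+1)\,\nu_1,$$ we have $$\forall n\in\mathbb N^*:\quad \sup_{x\in N}\|\mathrm D^nM(x)\|_{\mathcal B^n(\mathcal X_1;\mathcal X_3)}\le (n!)^s\mu\nu^n .$$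
   Context: $\mathbb N^*=\{1,2,\dots\}$. $\mathcal B^n(\mathcal X;\mathcal Y)$ is the Banach space of bounded $n$-linear maps $\mathcal X^n\to\mathcal Y$ with the usual operator norm. $\mathrm D^n$ is the $n$-th Fréchet derivative. *)

(* Defs.v *)
From HB Require Import structures.
From mathcomp Require Import all_boot all_order all_algebra.
From mathcomp Require Import all_classical all_reals all_analysis.

Set Implicit Arguments.
Unset Strict Implicit.
Unset Printing Implicit Defensive.

Import Order.TTheory GRing.Theory Num.Theory.
Import numFieldNormedType.Exports.

Local Open Scope classical_set_scope.
Local Open Scope ring_scope.

Section BoundedMultilinear.
Context {R : realType} (n : nat) (X Y : normedModType R).
Implicit Types (v : 'I_n -> X).

Definition multilinear (A : ('I_n -> X) -> Y) :=
  forall (i : 'I_n) v, linear (fun x : X => A (dfwith v i x)).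

Definition multibounded (A : ('I_n -> X) -> Y) :=
  exists C : R, forall v, `|A v| <= C * \prod_i `|v i|.

Definition bmlin_pred : {pred ('I_n -> X) -> Y} :=
  mem [set A | multilinear A /\ multibounded A].

Record bmlin := BMLin {
  bmlin_val :> ('I_n -> X) -> Y;
  _ : bmlin_val \in bmlin_pred }.

HB.instance Definition _ := [isSub for bmlin_val].
HB.instance Definition _ := [Choice of bmlin by <:].

Lemma bmlin_submod_closed : submod_closed bmlin_pred.
Proof.
split.
  apply/mem_set; split=> [i v a x y|].
    by rewrite /= [LHS]/0/= scaler0 addr0.
  by exists 0 => v; rewrite mul0r normr_le0.
move=> a A B /set_mem[Alin [CA ACA]] /set_mem[Blin [CB BCB]].
apply/mem_set; split=> [i v b x y|].
  rewrite -![_ (dfwith _ _ _)]/(a *: A _ + B _) Alin Blin.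
  by rewrite !scalerDr !scalerA (mulrC a b) addrACA.
exists (`|a| * CA + CB) => v.
rewrite -![_ v]/(a *: A _ + B _) (le_trans (ler_normD _ _))// mulrDl.
by rewrite lerD// normrZ -mulrA ler_wpM2l.
Qed.

HB.instance Definition _ := GRing.isSubmodClosed.Build R
  (('I_n -> X) -> Y) bmlin_pred bmlin_submod_closed.
HB.instance Definition _ := [SubChoice_isSubLmodule of bmlin by <:].

Lemma bmlin_multilinear (A : bmlin) : multilinear A.
Proof. by case: A => A /= /set_mem[]. Qed.

Lemma bmlin_bounded (A : bmlin) : multibounded A.
Proof. by case: A => A /= /set_mem[]. Qed.

Lemma bmlinP (A B : bmlin) : A =1 B -> A = B.
Proof. by move=> AB; apply/val_inj/funext. Qed.

Lemma bmlinD (A B : bmlin) v : (A + B) v = A v + B v.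
Proof. by []. Qed.

Lemma bmlinZ a (A : bmlin) v : (a *: A) v = a *: A v.
Proof. by []. Qed.

Definition unit_polyball : set ('I_n -> X) := [set v | forall i, `|v i| <= 1].

Definition opnorm (A : bmlin) : R := sup [set `|A v| | v in unit_polyball].

Lemma opnorm_has_sup (A : bmlin) : has_sup [set `|A v| | v in unit_polyball].
Proof.
split; first by exists `|A 0|; exists 0 => // i; rewrite normr0.
have [C AC] := bmlin_bounded A; exists `|C| => _ [v v1 <-].
rewrite (le_trans (AC v))// (le_trans (ler_norm _))// normrM ler_piMr//.
by rewrite ger0_norm ?prodr_ge0// prodr_ile1// => i _; rewrite normr_ge0 v1.
Qed.

Lemma opnorm_ge0 (A : bmlin) : 0 <= opnorm A.
Proof.
apply: (@le_trans _ _ `|A 0|) => //; apply: (sup_upper_bound (opnorm_has_sup A)).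
by exists 0 => // i; rewrite normr0.
Qed.

Lemma bmlin_scale1 (A : bmlin) i v c x :
  A (dfwith v i (c *: x)) = c *: A (dfwith v i x).
Proof.
have A0 : A (dfwith v i 0) = 0.
  have := bmlin_multilinear A i v (-1) 0 0.
  by rewrite scaleN1r oppr0 addr0 scaleN1r addNr.
by have := bmlin_multilinear A i v c x 0; rewrite addr0 A0 addr0.
Qed.

Lemma bmlin_scale (A : bmlin) (c : 'I_n -> R) v :
  A (fun i => c i *: v i) = (\prod_i c i) *: A v.
Proof.
suff H s : uniq s -> A (fun i => if i \in s then c i *: v i else v i) =
    (\prod_(i <- s) c i) *: A v.
  rewrite -(H (index_enum _)) ?index_enum_uniq//.
  by congr (A _); apply/funext => i; rewrite mem_index_enum.
elim: s => [_|j s IH /= /andP[js us]].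
  by rewrite big_nil scale1r.
rewrite big_cons -scalerA -IH//.
set w := fun i => if i \in s then c i *: v i else v i.
have -> : w = dfwith w j (v j).
  apply/funext => i; have [ij|ij] := eqVneq j i.
    by rewrite -ij dfwithin /w (negbTE js).
  by rewrite dfwithout.
rewrite -bmlin_scale1; congr (A _); apply/funext => i.
have [ij|ij] := eqVneq j i.
  by rewrite -ij dfwithin mem_head.
by rewrite !dfwithout// in_cons eq_sym (negbTE ij).
Qed.

Lemma ler_opnorm (A : bmlin) v : `|A v| <= opnorm A * \prod_i `|v i|.
Proof.
have [[i vi0]|v0] := pselect (exists i, v i = 0).
  have vE : v = dfwith v i (0 *: 0).
    apply/funext => j; have [ij|ij] := eqVneq i j.
      by rewrite -ij dfwithin scaler0.
    by rewrite dfwithout.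
  by rewrite {1}vE bmlin_scale1 scale0r normr0 mulr_ge0 ?opnorm_ge0 ?prodr_ge0.
have {}v0 i : `|v i| != 0.
  by rewrite normr_eq0; apply/eqP => vi0; apply: v0; exists i.
have -> : v = fun i => `|v i| *: (`|v i|^-1 *: v i).
  by apply/funext => i; rewrite scalerA divff// scale1r.
rewrite bmlin_scale normrZ ger0_norm ?prodr_ge0// mulrC.
under [in leRHS]eq_bigr do rewrite scalerA divff// scale1r.
rewrite ler_wpM2r ?prodr_ge0//.
apply: (sup_upper_bound (opnorm_has_sup A)) => /=.
by eexists; last reflexivity; move=> i; rewrite normrZ normfV normr_id mulVf.
Qed.

Lemma opnorm_le (A : bmlin) C : 0 <= C ->
  (forall v, `|A v| <= C * \prod_i `|v i|) -> opnorm A <= C.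
Proof.
move=> C0 AC; apply: ge_sup; first by have [] := opnorm_has_sup A.
move=> _ [v v1 <-]; rewrite (le_trans (AC v))// ler_piMr//.
by rewrite prodr_ile1// => i _; rewrite normr_ge0 v1.
Qed.

Let opnormD (A B : bmlin) : opnorm (A + B) <= opnorm A + opnorm B.
Proof.
apply: opnorm_le => [|v]; first by rewrite addr_ge0 ?opnorm_ge0.
by rewrite bmlinD (le_trans (ler_normD _ _))// mulrDl lerD ?ler_opnorm.
Qed.

Let opnormZ_le a (A : bmlin) : opnorm (a *: A) <= `|a| * opnorm A.
Proof.
apply: opnorm_le => [|v]; first by rewrite mulr_ge0 ?opnorm_ge0.
by rewrite bmlinZ normrZ -mulrA ler_wpM2l ?ler_opnorm.
Qed.

Let opnormZ a (A : bmlin) : opnorm (a *: A) = `|a| * opnorm A.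
Proof.
apply/eqP; rewrite eq_le opnormZ_le /=.
have [->|a0] := eqVneq a 0; first by rewrite normr0 mul0r opnorm_ge0.
rewrite -ler_pdivlMl ?normr_gt0//.
by rewrite -{1}[A](scalerK a0) (le_trans (opnormZ_le _ _))// normfV.
Qed.

Let opnorm0_eq0 (A : bmlin) : opnorm A = 0 -> A = 0.
Proof.
move=> A0; apply/bmlinP => v; apply/eqP; rewrite -normr_le0.
by rewrite (le_trans (ler_opnorm A v))// A0 mul0r.
Qed.

HB.instance Definition _ :=
  Lmodule_isNormed.Build R bmlin opnormD opnormZ opnorm0_eq0.

Lemma bmlin_normE (A : bmlin) : `|A| = sup [set `|A v| | v in unit_polyball].
Proof. by []. Qed.

End BoundedMultilinear.

Section IteratedDerivative.
Context {R : realType} {X Y : normedModType R}.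

Fact bmlin0_subproof (y : Y) : (fun=> y) \in @bmlin_pred R 0 X Y.
Proof.
apply/mem_set; split=> [[]//|].
by exists `|y| => v; rewrite big_ord0 mulr1.
Qed.

Definition bmlin0 (y : Y) : bmlin 0 X Y := BMLin (bmlin0_subproof y).

Fact bmlin0_linear : linear (bmlin0).
Proof. by move=> a x y; apply/bmlinP. Qed.

HB.instance Definition _ :=
  GRing.isLinear.Build R Y (bmlin 0 X Y) _ bmlin0 bmlin0_linear.

Lemma normr_bmlin0 y : `|bmlin0 y| = `|y|.
Proof.
rewrite bmlin_normE (_ : [set _ | _ in _] = [set `|y|]) ?sup1//.
apply/seteqP; split=> [_ [v _ <-]//|_ ->]; exists 0 => //.
by move=> i; rewrite normr0.
Qed.

Lemma bmlin0_continuous : continuous (bmlin0).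
Proof.
apply: bounded_linear_continuous; apply/linear_boundedP.
by near=> r => y; rewrite normr_bmlin0 ler_peMl//; near: r; exact: nbhs_pinfty_ge.
Unshelve. all: by end_near. Qed.

(* The image of L under B(X; B^n(X; Y)) ~ B^{n+1}(X; Y); the default value 0 is
   taken only when L is not continuous, cf. [bmlin_uncurryE]. *)
Definition bmlin_uncurry n (L : {linear X -> bmlin n X Y}) : bmlin n.+1 X Y :=
  insubd 0 (fun v : 'I_n.+1 -> X => L (v ord0) (fun i => v (lift ord0 i))).

Lemma bmlin_uncurryE n (L : {linear X -> bmlin n X Y}) : continuous L ->
  forall v, bmlin_uncurry L v = L (v ord0) (fun i => v (lift ord0 i)).
Proof.
move=> Lc v; rewrite /bmlin_uncurry /insubd insubT//=.
apply/mem_set; split=> [i w a x y|].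
  have [->|[j ->]] : i = ord0 \/ exists j, i = lift ord0 j.
    by case: (unliftP ord0 i) => [j ->|->]; [right; exists j|left].
  - rewrite !dfwithin linearP.
    have H z : (fun k => dfwith w ord0 z (lift ord0 k)) =
        fun k : 'I_n => w (lift ord0 k).
      by apply/funext => k; rewrite dfwithout.
    by rewrite !H.
  - have H z : (fun k => dfwith w (lift ord0 j) z (lift ord0 k)) =
        dfwith (fun k : 'I_n => w (lift ord0 k)) j z.
      apply/funext => k; have [->|kj] := eqVneq j k; first by rewrite !dfwithin.
      by rewrite !dfwithout// (inj_eq lift_inj).
    by rewrite !dfwithout// !H; exact: bmlin_multilinear.
have /linear_boundedP/pinfty_ex_gt0[C C0 LC] :=
  continuous_linear_bounded 0 (Lc 0).
exists C => w; rewrite big_ord_recl mulrA (le_trans (ler_opnorm _ _))//.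
by rewrite ler_wpM2r ?prodr_ge0//; exact: LC.
Qed.

(* The n-th Frechet derivative:
   D^{n+1} f (x) (v_0, ..., v_n) = (D (D^n f) (x) v_0) (v_1, ..., v_n). *)
Fixpoint frechet n (f : X -> Y) (x : X) : bmlin n X Y :=
  match n with
  | 0 => bmlin0 (f x)
  | m.+1 => bmlin_uncurry ('d (frechet m f) x)
  end.

Lemma frechet1E (f : X -> Y) x v : differentiable f x ->
  frechet 1 f x v = 'd f x (v ord0).
Proof.
move=> df; rewrite /= bmlin_uncurryE; last first.
  apply: diff_continuous.
  apply: (differentiable_comp df); apply: linear_differentiable.
  exact: bmlin0_continuous.
rewrite (_ : 'd _ x = bmlin0 \o 'd f x :> (_ -> _))//.
have dl : differentiable (bmlin0) (f x).
  by apply: linear_differentiable; exact: bmlin0_continuous.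
have -> : 'd (frechet 0 f) x = 'd (bmlin0) (f x) \o 'd f x :> (_ -> _).
  exact: (diff_comp df dl).
by rewrite (diff_lin (f x) bmlin0_continuous).
Qed.

Definition smooth_on (N : set X) (f : X -> Y) :=
  forall n x, N x -> differentiable (frechet n f) x.

(* The data N, mu, nu witness that f, regarded as a map defined on the open set
   U, is s-Gevrey at x; since N is an open subset of U, the values of f outside
   U play no role. The supremum is taken in the extended reals, so that it is
   +oo when the derivative is unbounded on N. *)
Definition gevrey_with (U : set X) (f : X -> Y) (s : R) (x : X)
    (N : set X) (mu nu : R) :=
  [/\ open N, N `<=` U, N x, smooth_on N f &
   [/\ 0 <= mu, 0 <= nu &
    forall n : nat, (0 < n)%N ->
      (ereal_sup [set `|frechet n f y|%:E | y in N] <=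
        (n`!%:R `^ s * mu * nu ^+ n)%:E)%E]].

Definition gevrey_at (U : set X) (f : X -> Y) (s : R) (x : X) :=
  exists N mu nu, gevrey_with U f s x N mu nu.

End IteratedDerivative.

(* Main.v *)
(* By the chain rule D (M2 \o M1) = (D M2 \o M1) o D M1, a composition inside
   spaces of linear maps, the derivatives of M2 \o M1 are estimated by recursion:
   the Leibniz inequality for this bilinear composition reduces the order n.+1
   to the derivatives of order at most n of D M2 \o M1 and of D M1. The factorial
   weights are controlled by m.+1 * j! * (n.+1 - j)! <= n.+1! for m <= j <= n,
   whose (s - 1)-th power reduces the estimate to s = 1. There it is the power
   series expansion of g \o f, where f t = mu1 nu1 t / (1 - nu1 t) and
   g u = mu2 / (1 - nu2 u), whose n-th coefficient is mu nu ^ n. *)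
From HB Require Import structures.
Require Import Defs.
From mathcomp Require Import all_boot all_order all_algebra.
From mathcomp Require Import all_classical all_reals all_analysis.
From mathcomp Require Import ring.
Import Order.TTheory GRing.Theory Num.Theory.
Import numFieldNormedType.Exports.
Local Open Scope classical_set_scope.
Local Open Scope ring_scope.

Set Implicit Arguments.
Unset Strict Implicit.
Unset Printing Implicit Defensive.

(** * Bounded linear maps, contractions and their lifts *)

Section OperatorSpace.
Context {R : realType}.
Implicit Types X Y Z : normedModType R.

Definition app1 X Y (A : bmlin 1 X Y) (x : X) : Y := A (fun=> x).

(* Junk value 0 unless h is linear and bounded. *)
Definition bmlin1 X Y (h : X -> Y) : bmlin 1 X Y :=
  insubd 0 (fun v : 'I_1 -> X => h (v ord0)).

Lemma norm_bmlin_le n X Y (A : bmlin n X Y) C : 0 <= C ->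
  (forall v, `|A v| <= C * \prod_i `|v i|) -> `|A| <= C.
Proof. exact: opnorm_le. Qed.

Lemma norm_bmlin_ge n X Y (A : bmlin n X Y) v :
  `|A v| <= `|A| * \prod_i `|v i|.
Proof. exact: ler_opnorm. Qed.

Lemma app1E X Y (A : bmlin 1 X Y) v : A v = app1 A (v ord0).
Proof. by congr (A _); apply/funext => i; rewrite ord1. Qed.

Lemma app1_inj X Y (A A' : bmlin 1 X Y) : app1 A =1 app1 A' -> A = A'.
Proof. by move=> AA'; apply/bmlinP => v; rewrite !app1E AA'. Qed.

Lemma app1P X Y a (A A' : bmlin 1 X Y) x :
  app1 (a *: A + A') x = a *: app1 A x + app1 A' x.
Proof. by []. Qed.

Lemma app1_linear X Y (A : bmlin 1 X Y) : linear (app1 A).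
Proof.
move=> a x y.
have E z : app1 A z = A (dfwith (fun=> 0) (ord0 : 'I_1) z).
  by rewrite app1E dfwithin.
by rewrite !E bmlin_multilinear.
Qed.

Lemma app1_le X Y (A : bmlin 1 X Y) x : `|app1 A x| <= `|A| * `|x|.
Proof. by rewrite (le_trans (norm_bmlin_ge _ _))// big_ord1. Qed.

Lemma norm_bmlin1_le X Y (A : bmlin 1 X Y) C : 0 <= C ->
  (forall x, `|app1 A x| <= C * `|x|) -> `|A| <= C.
Proof.
by move=> C0 Ale; apply: norm_bmlin_le => // v; rewrite app1E big_ord1 Ale.
Qed.

Lemma bmlin1E X Y (h : X -> Y) C : linear h ->
  (forall x, `|h x| <= C * `|x|) -> app1 (bmlin1 h) =1 h.
Proof.
move=> hlin hle x; rewrite /app1 /bmlin1 /insubd insubT//=.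
apply/mem_set; split=> [i v a y z|]; last by exists C => v; rewrite big_ord1.
by rewrite ord1 !dfwithin hlin.
Qed.

Lemma norm_bmlin1 X Y (h : X -> Y) C : 0 <= C -> linear h ->
  (forall x, `|h x| <= C * `|x|) -> `|bmlin1 h| <= C.
Proof.
by move=> C0 hl hle; apply: norm_bmlin1_le => // x; rewrite (bmlin1E hl hle).
Qed.

(** With the constant fixed at 1, composing with [L] preserves any majorant of the derivatives, so
    no constants accumulate along the recursion. The same holds for the bilinear version. *)
Definition contraction_linear X Y (L : X -> Y) :=
  linear L /\ forall x, `|L x| <= `|x|.

Definition contraction_bilinear X Y Z (B : X -> Y -> Z) :=
  [/\ forall y, linear (B^~ y), forall x, linear (B x)
    & forall x y, `|B x y| <= `|x| * `|y|].

Section Lifts.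
Context {X U V W : normedModType R}.

Definition post1 (L : U -> V) (A : bmlin 1 X U) : bmlin 1 X V :=
  bmlin1 (L \o app1 A).

Lemma post1E L A : contraction_linear L ->
  app1 (post1 L A) =1 L \o app1 A.
Proof.
move=> [Ll L1]; apply: (@bmlin1E _ _ _ `|A|) => [a x y|x] /=.
  by rewrite app1_linear Ll.
by rewrite (le_trans (L1 _))// app1_le.
Qed.

Lemma post1_contraction L : contraction_linear L ->
  contraction_linear (post1 L).
Proof.
move=> cL; split=> [a A A'|A].
  by apply: app1_inj => x; rewrite app1P !post1E//=; case: cL => ->.
apply: norm_bmlin1_le => // x; rewrite post1E//=.
by case: cL => _ L1; rewrite (le_trans (L1 _))// app1_le.
Qed.

(** [lift1l] and [lift1r] are the two halves of the product rule: the derivative of [B (u x) (v x)]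
    is [lift1l B (u' x) (v x) + lift1r B (u x) (v' x)]. Both are again contractive in their two
    arguments, so the product rule can be iterated. *)
Definition lift1l (B : U -> V -> W) (A : bmlin 1 X U) (v : V) : bmlin 1 X W :=
  bmlin1 (fun x => B (app1 A x) v).

Definition lift1r (B : U -> V -> W) (u : U) (A : bmlin 1 X V) : bmlin 1 X W :=
  bmlin1 (fun x => B u (app1 A x)).

Lemma lift1lE B A v : contraction_bilinear B ->
  app1 (lift1l B A v) =1 fun x => B (app1 A x) v.
Proof.
move=> [Bl _ B1]; apply: (@bmlin1E _ _ _ (`|A| * `|v|)) => [a x y|x].
  by rewrite app1_linear Bl.
by rewrite (le_trans (B1 _ _))// mulrAC ler_wpM2r ?app1_le.
Qed.

Lemma lift1rE B u A : contraction_bilinear B ->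
  app1 (lift1r B u A) =1 fun x => B u (app1 A x).
Proof.
move=> [_ Br B1]; apply: (@bmlin1E _ _ _ (`|u| * `|A|)) => [a x y|x].
  by rewrite app1_linear Br.
by rewrite (le_trans (B1 _ _))// -mulrA ler_wpM2l ?app1_le.
Qed.

Lemma lift1l_contraction B : contraction_bilinear B ->
  contraction_bilinear (lift1l B).
Proof.
move=> cB; have [Bl Br B1] := cB; split=> [v a A A'|A a v v'|A v].
- apply: app1_inj => x.
  by rewrite app1P !lift1lE// -Bl.
- apply: app1_inj => x.
  by rewrite app1P !lift1lE// -Br.
- apply: norm_bmlin1_le => [|x]; first by rewrite mulr_ge0.
  by rewrite lift1lE// (le_trans (B1 _ _))// mulrAC ler_wpM2r ?app1_le.
Qed.

Lemma lift1r_contraction B : contraction_bilinear B ->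
  contraction_bilinear (lift1r B).
Proof.
move=> cB; have [Bl Br B1] := cB; split=> [A a u u'|u a A A'|u A].
- apply: app1_inj => x.
  by rewrite app1P !lift1rE// -Bl.
- apply: app1_inj => x.
  by rewrite app1P !lift1rE// -Br.
- apply: norm_bmlin1_le => [|x]; first by rewrite mulr_ge0.
  by rewrite lift1rE// (le_trans (B1 _ _))// -mulrA ler_wpM2l ?app1_le.
Qed.

Definition comp1 (A : bmlin 1 U V) (A' : bmlin 1 X U) : bmlin 1 X V :=
  bmlin1 (app1 A \o app1 A').

Lemma comp1E A A' : app1 (comp1 A A') =1 app1 A \o app1 A'.
Proof.
apply: (@bmlin1E _ _ _ (`|A| * `|A'|)) => [a x y|x] /=.
  by rewrite !app1_linear.
by rewrite (le_trans (app1_le _ _))// -mulrA ler_wpM2l ?app1_le.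
Qed.

Lemma comp1_contraction : contraction_bilinear comp1.
Proof.
split=> [A' a A1 A2|A a A1 A2|A A'].
- apply: app1_inj => x.
  by rewrite app1P !comp1E.
- apply: app1_inj => x.
  rewrite app1P !comp1E/=.
  by rewrite -app1_linear.
- apply: norm_bmlin1_le => [|x]; first by rewrite mulr_ge0.
  by rewrite comp1E (le_trans (app1_le _ _))// -mulrA ler_wpM2l ?app1_le.
Qed.

End Lifts.

(** * The identification of B^{n+1}(X; Y) with B(X; B^n(X; Y)) *)

Section Currying.
Context {X Y : normedModType R} (n : nat).

Definition fcons (x : X) (w : 'I_n -> X) (i : 'I_n.+1) : X :=
  if unlift ord0 i is Some j then w j else x.

Lemma fcons0 x w : fcons x w ord0 = x.
Proof. by rewrite /fcons unlift_none. Qed.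

Lemma fcons_lift x w j : fcons x w (lift ord0 j) = w j.
Proof. by rewrite /fcons liftK. Qed.

Lemma fcons_eta v : fcons (v ord0) (v \o lift ord0) = v.
Proof.
by apply/funext => i; rewrite /fcons; case: unliftP => [j ->|->].
Qed.

Lemma fcons_dfwith0 x w y : fcons x w = dfwith (fcons y w) ord0 x.
Proof.
apply/funext => i; case: (unliftP ord0 i) => [j ->|->].
  by rewrite dfwithout// !fcons_lift.
by rewrite dfwithin fcons0.
Qed.

Lemma fcons_dfwithS x w j y :
  fcons x (dfwith w j y) = dfwith (fcons x w) (lift ord0 j) y.
Proof.
apply/funext => i; case: (unliftP ord0 i) => [k ->|->].
  rewrite fcons_lift; have [->|jk] := eqVneq j k; first by rewrite !dfwithin.
  by rewrite !dfwithout ?fcons_lift// (inj_eq lift_inj).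
by rewrite dfwithout// !fcons0.
Qed.

Lemma norm_fcons x w :
  \prod_i `|fcons x w i| = `|x| * \prod_i `|w i|.
Proof.
rewrite big_ord_recl fcons0; congr (_ * _).
by apply: eq_bigr => i _; rewrite fcons_lift.
Qed.

Definition curry_fun (A : bmlin n.+1 X Y) (x : X) : bmlin n X Y :=
  insubd 0 (fun w => A (fcons x w)).

Lemma curry_funE A x w : curry_fun A x w = A (fcons x w).
Proof.
rewrite /curry_fun /insubd insubT//=; apply/mem_set; split=> [i v a y z|].
  by rewrite !fcons_dfwithS bmlin_multilinear.
exists (`|A| * `|x|) => v.
by rewrite (le_trans (norm_bmlin_ge _ _))// norm_fcons mulrA.
Qed.

Lemma curry_fun_linear A : linear (curry_fun A).
Proof.
move=> a x y; apply: bmlinP => w.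
rewrite !bmlinD !bmlinZ !curry_funE.
have E z : A (fcons z w) = A (dfwith (fcons 0 w) ord0 z).
  by rewrite -fcons_dfwith0.
by rewrite !E bmlin_multilinear.
Qed.

Lemma curry_fun_le A x : `|curry_fun A x| <= `|A| * `|x|.
Proof.
apply: norm_bmlin_le => [|w]; first by rewrite mulr_ge0.
by rewrite curry_funE -mulrA -norm_fcons norm_bmlin_ge.
Qed.

Definition curry1 (A : bmlin n.+1 X Y) : bmlin 1 X (bmlin n X Y) :=
  bmlin1 (curry_fun A).

Lemma curry1E A x w : app1 (curry1 A) x w = A (fcons x w).
Proof.
by rewrite (bmlin1E (curry_fun_linear A) (curry_fun_le A)) curry_funE.
Qed.

Lemma curry1_contraction : contraction_linear curry1.
Proof.
split=> [a A A'|A].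
  apply: app1_inj => x; apply: bmlinP => w; rewrite curry1E.
  by rewrite app1P !bmlinD !bmlinZ !curry1E.
exact: norm_bmlin1 (curry_fun_linear A) (curry_fun_le A).
Qed.

Definition uncurry1 (A : bmlin 1 X (bmlin n X Y)) : bmlin n.+1 X Y :=
  insubd 0 (fun v => app1 A (v ord0) (v \o lift ord0)).

Lemma uncurry1E A v : uncurry1 A v = app1 A (v ord0) (v \o lift ord0).
Proof.
rewrite /uncurry1 /insubd insubT//=; apply/mem_set; split=> [i w a x y|].
  rewrite -(fcons_eta w); move: (w ord0) (w \o _) => {w} z w.
  case: (unliftP ord0 i) => [j ->|->].
    rewrite -!fcons_dfwithS !fcons0.
    have E u : fcons z u \o lift ord0 = u by apply/funext => k /=; rewrite fcons_lift.
    by rewrite !E bmlin_multilinear.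
  rewrite -!fcons_dfwith0 !fcons0 app1_linear.
  have E u : fcons u w \o lift ord0 = w by apply/funext => k /=; rewrite fcons_lift.
  by rewrite !E.
exists `|A| => w; rewrite (le_trans (norm_bmlin_ge _ _))//.
by rewrite big_ord_recl mulrA ler_wpM2r ?prodr_ge0// app1_le.
Qed.

Lemma uncurry1_contraction : contraction_linear uncurry1.
Proof.
split=> [a A A'|A].
  apply: bmlinP => v.
  by rewrite !bmlinD !bmlinZ !uncurry1E.
apply: norm_bmlin_le => // v; rewrite uncurry1E (le_trans (norm_bmlin_ge _ _))//.
by rewrite big_ord_recl mulrA ler_wpM2r ?prodr_ge0// app1_le.
Qed.

End Currying.

(** * Differentiability of contractions and locality of the derivative *)

Lemma is_diff_eps X Y (f L : X -> Y) C x : linear L ->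
  (forall h, `|L h| <= C * `|h|) ->
  (forall e, 0 < e ->
     \forall h \near 0, `|f (h + x) - f x - L h| <= e * `|h|) ->
  is_diff x f L.
Proof.
move=> Ll Lle fL.
pose L' : {linear X -> Y} := HB.pack L (GRing.isLinear.Build _ _ _ _ _ Ll).
have Lc : continuous L'.
  apply: bounded_linear_continuous; apply/linear_boundedP.
  apply: filterS (nbhs_pinfty_ge (num_real C)) => r Cr h.
  by rewrite (le_trans (Lle h))// ler_wpM2r.
have E : f \o shift x = cst (f x) + L' +o_ 0 id.
  apply/eqaddoP => e e0; apply: filterS (fL e e0) => h.
  by rewrite /= !fctE opprD addrA.
have dE := diff_unique Lc E; split => //.
by apply/diff_locallyP; rewrite dE.
Qed.

Lemma is_diff_contraction X Y (L : X -> Y) x : contraction_linear L -> is_diff x L L.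
Proof.
move=> [Ll L1]; apply: (@is_diff_eps _ _ _ _ 1) => // [h|e e0].
  by rewrite mul1r.
near=> h; have := Ll 1 h x; rewrite !scale1r => ->.
by rewrite addrK subrr normr0 mulr_ge0// ltW.
Unshelve. all: by end_near. Qed.

Lemma is_diff_bilinear X Y Z (B : X -> Y -> Z) p : contraction_bilinear B ->
  is_diff p (fun q => B q.1 q.2) (fun q => B p.1 q.2 + B q.1 p.2).
Proof.
case: p => x y [Bl Br B1].
have BDl u u' v : B (u + u') v = B u v + B u' v.
  by have := Bl v 1 u u'; rewrite !scale1r.
have BDr u v v' : B u (v + v') = B u v + B u v'.
  by have := Br u 1 v v'; rewrite !scale1r.
apply: (@is_diff_eps _ _ _ _ (`|x| + `|y|)) => [a [u v] [u' v']|[u v]|e e0] /=.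
- by rewrite Bl Br scalerDr addrACA.
- rewrite (le_trans (ler_normD _ _))// mulrDl lerD// (le_trans (B1 _ _))//.
    by rewrite ler_wpM2l// le_max lexx orbT.
  by rewrite mulrC ler_wpM2l// le_max lexx.
- near=> q => /=; rewrite BDl !BDr.
  (* The remainder of [B] at [(x, y)] is exactly [B q.1 q.2], which is quadratic in [q]. *)
  rewrite [X in `|X|](_ : _ = B q.1 q.2); last first.
    by rewrite !addrA addrK opprD addrA addrK addrK.
  rewrite (le_trans (B1 _ _))// ler_pM//; last by rewrite le_max lexx orbT.
  apply: (@le_trans _ _ `|q|); first by rewrite le_max lexx.
  by near: q; exact: (@nbhs0_le R (X * Y)%type e e0).
Unshelve. all: by end_near. Qed.

Lemma is_diff_local X Y (f g L : X -> Y) (N : set X) x : open N -> N x ->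
  (forall y, N y -> f y = g y) -> is_diff x f L -> is_diff x g L.
Proof.
move=> oN Nx fg [df <-].
have /linear_boundedP/pinfty_ex_gt0[C _ dC] :=
  continuous_linear_bounded 0 (@diff_continuous _ _ _ _ _ df 0).
apply: (@is_diff_eps _ _ _ _ C) => // [a u v|e e0]; first exact: linearP.
have [_ /eqaddoP fE] := (diff_locallyP x f).1 df.
have Nh : \forall h \near (0 : X), N (h + x).
  have : \forall y \near x, N y by exact: open_nbhs_nbhs.
  by move=> /nbhs0P; apply: filterS => h; rewrite addrC.
near=> h; rewrite -!fg//; last by near: h.
have : `|(f \o shift x - (cst (f x) + 'd f x)) h| <= e * `|h|.
  by near: h; exact: fE.
by rewrite !fctE/= opprD addrA.
Unshelve. all: by end_near. Qed.

End OperatorSpace.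

(** * Majorants of operator-valued iterated derivatives *)

Section BoundedDerivatives.
Context {R : realType} {X : normedModType R}.
Implicit Types (N : set X) (Y Z U V : normedModType R) (a b : nat -> R).

(* The majorant a bounds the derivatives of orders 1 to n only: a 0 is ignored,
   as f itself need not be bounded. The operator-valued f' is only determined
   on N. *)
Fixpoint bounded_derivs N n :
    forall Y : normedModType R, (X -> Y) -> (nat -> R) -> Prop :=
  match n with
  | 0 => fun _ _ _ => True
  | m.+1 => fun Y f a => exists f' : X -> bmlin 1 X Y,
      [/\ forall x, N x -> is_diff x f (app1 (f' x)),
          forall x, N x -> `|f' x| <= a 1%N
        & bounded_derivs N m f' (fun k => a k.+1)]
  end.

Lemma bounded_derivs_le N n Y (f : X -> Y) a b :
  (forall k, (0 < k <= n)%N -> a k <= b k) ->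
  bounded_derivs N n f a -> bounded_derivs N n f b.
Proof.
elim: n Y f a b => [//|n IH] Y f a b ab [f' [ff' f'a df']].
exists f'; split=> // [x Nx|]; first by rewrite (le_trans (f'a x Nx))// ab.
by apply: IH df' => k /andP[_ kn]; rewrite ab.
Qed.

Lemma bounded_derivs_leq N n m Y (f : X -> Y) a : (m <= n)%N ->
  bounded_derivs N n f a -> bounded_derivs N m f a.
Proof.
elim: n m Y f a => [|n IH] [|m] // Y f a mn [f' [ff' f'a df']].
by exists f'; split=> //; exact: IH df'.
Qed.

Lemma bounded_derivs_sub N N' n Y (f : X -> Y) a : N' `<=` N ->
  bounded_derivs N n f a -> bounded_derivs N' n f a.
Proof.
move=> N'N; elim: n Y f a => [//|n IH] Y f a [f' [ff' f'a df']].
by exists f'; split=> [x /N'N|x /N'N|]; [exact: ff'|exact: f'a|exact: IH].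
Qed.

Lemma bounded_derivs_eq N n Y (f g : X -> Y) a : open N ->
  (forall x, N x -> f x = g x) ->
  bounded_derivs N n f a -> bounded_derivs N n g a.
Proof.
move=> oN fg; case: n => [//|n] [f' [ff' f'a df']].
by exists f'; split=> // x Nx; exact: (is_diff_local oN Nx fg (ff' x Nx)).
Qed.

Lemma bounded_derivs_post N n Y Z (L : Y -> Z) (f : X -> Y) a :
  contraction_linear L ->
  bounded_derivs N n f a -> bounded_derivs N n (L \o f) a.
Proof.
elim: n Y Z L f a => [//|n IH] Y Z L f a cL [f' [ff' f'a df']].
exists (post1 L \o f'); split=> [x Nx|x Nx|].
- rewrite /= (funext (post1E _ cL)); apply: is_diff_comp (ff' x Nx) _.
  exact: is_diff_contraction.
- rewrite /= (le_trans _ (f'a x Nx))//.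
  by have [_] := post1_contraction (X := X) cL; exact.
- by apply: IH df'; exact: post1_contraction.
Qed.

Lemma bounded_derivsD N n Y (f g : X -> Y) a b :
  bounded_derivs N n f a -> bounded_derivs N n g b ->
  bounded_derivs N n (f \+ g) (fun k => a k + b k).
Proof.
elim: n Y f g a b => [//|n IH] Y f g a b.
move=> [f' [ff' f'a df']] [g' [gg' g'b dg']].
exists (f' \+ g'); split=> [x Nx|x Nx|]; last exact: IH.
- have -> : app1 (f' x + g' x) = app1 (f' x) + app1 (g' x) by [].
  exact: is_diffD (ff' x Nx) (gg' x Nx).
- by rewrite (le_trans (ler_normD _ _))// lerD ?f'a ?g'b.
Qed.

(* lconv a b k is the sum of 'C(k, j) a j b (k - j), presented by the Leibniz
   rule itself. *)
Fixpoint lconv (a b : nat -> R) k : R :=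
  if k is l.+1 then
    lconv (fun j => a j.+1) b l + lconv a (fun j => b j.+1) l
  else a 0%N * b 0%N.

(** Differentiating gives two terms of the same shape, with lifted contractions applied to [(u', v)]
    and [(u, v')]; this is the recursion of [lconv], so the induction must quantify over [B] and the
    spaces. The bounds of order 0 are separate hypotheses because [bounded_derivs] leaves [a 0]
    out. *)
Lemma bounded_derivs_bilinear N n U V Y (B : U -> V -> Y) u v a b :
  contraction_bilinear B ->
  (forall x, N x -> `|u x| <= a 0%N) -> (forall x, N x -> `|v x| <= b 0%N) ->
  bounded_derivs N n u a -> bounded_derivs N n v b ->
  bounded_derivs N n (fun x => B (u x) (v x)) (lconv a b).
Proof.
elim: n U V Y B u v a b => [//|n IH] U V Y B u v a b cB u0 v0 du dv.
have du_n := bounded_derivs_leq (leqnSn n) du.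
have dv_n := bounded_derivs_leq (leqnSn n) dv.
case: du => [u' [uu' u'a du']]; case: dv => [v' [vv' v'b dv']].
have cl := lift1l_contraction (X := X) cB.
have cr := lift1r_contraction (X := X) cB.
exists ((fun x => lift1l B (u' x) (v x)) \+ (fun x => lift1r B (u x) (v' x))).
split=> [x Nx|x Nx|].
- have p := is_diff_pair (uu' x Nx) (vv' x Nx).
  have := is_diff_comp p (is_diff_bilinear (u x, v x) cB).
  rewrite [X in is_diff _ _ X](_ : _ = app1 ((((fun x => lift1l B (u' x) (v x))
    \+ (fun x => lift1r B (u x) (v' x)))) x))//.
  apply/funext => h /=; rewrite addrC -(lift1lE (u' x) _ cB).
  by rewrite -(lift1rE (u x) (v' x) cB).
- rewrite /= (le_trans (ler_normD _ _))// lerD//.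
    by have [_ _ /(_ (u' x) (v x)) /le_trans] := cl; apply; rewrite ler_pM ?u'a ?v0.
  by have [_ _ /(_ (u x) (v' x)) /le_trans] := cr; apply; rewrite ler_pM ?v'b ?u0.
- by apply: bounded_derivsD; apply: IH.
Qed.

End BoundedDerivatives.

(** * The chain rule for majorants *)

Section Composition.
Context {R : realType} {X Y : normedModType R}.

(* C i k bounds the k-th derivative of D^i g \o f. *)
Lemma bounded_derivs_comp (N : set X) (N' : set Y) n (Z : normedModType R)
    (f : X -> Y) (g : Y -> Z) (a b : nat -> R) (C : nat -> nat -> R) :
  (forall x, N x -> N' (f x)) ->
  (forall i, b i <= C i 0%N) ->
  (forall i k, lconv (C i.+1) (fun j => a j.+1) k <= C i k.+1) ->
  bounded_derivs N n f a -> bounded_derivs N' n g b ->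
  bounded_derivs N n (g \o f) (C 0%N).
Proof.
elim: n Z g b C => [//|n IH] Z g b C fN bC CC df [g' [gg' g'b dg']].
have df_n := bounded_derivs_leq (leqnSn n) df.
case: df => [f' [ff' f'a df']].
exists (fun x => comp1 (g' (f x)) (f' x)); split=> [x Nx|x Nx|].
- rewrite (funext (comp1E _ _)).
  exact: is_diff_comp (ff' x Nx) (gg' _ (fN x Nx)).
- have [_ _ /(_ (g' (f x)) (f' x)) /le_trans] := @comp1_contraction R X Y Z.
  apply; rewrite (le_trans _ (CC 0%N 0%N))//= ler_pM ?f'a//.
  by rewrite (le_trans (g'b _ (fN x Nx)))// bC.
(* The derivative is the product of [g' \o f] and [f'] under [comp1]; Leibniz bounds it by
   [lconv (C 1)] of the shifted [a], which [CC] absorbs into the shifted [C 0]. *)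
- apply: bounded_derivs_le (fun k _ => CC 0%N k) _.
  apply: (bounded_derivs_bilinear (u := g' \o f)) => //.
  + exact: comp1_contraction.
  + by move=> x Nx; rewrite (le_trans (g'b _ (fN x Nx)))// bC.
  (* Passing from [g] to [g'] raises the order of the outer derivative by one, hence the shift of
     [b] and of the first index of [C]. *)
  + by apply: (IH _ _ (fun k => b k.+1) (fun i => C i.+1)).
Qed.

End Composition.

(** * Passage between [frechet] and the operator-valued derivatives *)

Section FrechetBoundedDerivs.
Context {R : realType} {X Y : normedModType R}.
Implicit Types (f : X -> Y) (N : set X) (a : nat -> R).

Lemma bmlin0_contraction : contraction_linear (@bmlin0 R X Y).
Proof.
by split=> [|y]; [exact: bmlin0_linear|rewrite normr_bmlin0].
Qed.

Lemma eval_bmlin0_contraction :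
  contraction_linear (fun A : bmlin 0 X Y => A (fun=> 0)).
Proof.
by split=> // A; rewrite (le_trans (norm_bmlin_ge _ _))// big_ord0 mulr1.
Qed.

Lemma frechetS_app1 n f x (A : bmlin 1 X (bmlin n X Y)) :
  is_diff x (frechet n f) (app1 A) -> frechet n.+1 f x = uncurry1 A.
Proof.
move=> [df dE]; apply: bmlinP => v /=.
(* Continuity of the differential rules out the default value 0 of [bmlin_uncurry]. *)
rewrite bmlin_uncurryE; last exact: diff_continuous.
by rewrite dE uncurry1E.
Qed.

Lemma is_diff_frechet n f x : differentiable (frechet n f) x ->
  is_diff x (frechet n f) (app1 (curry1 (frechet n.+1 f x))).
Proof.
move=> df; apply: (is_diff_eq (differentiableP df)).
apply/funext => h; apply: bmlinP => w; rewrite curry1E /=.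
rewrite bmlin_uncurryE; last exact: diff_continuous.
have wE : (fun i => fcons h w (lift ord0 i)) = w.
  by apply/funext => i; exact: fcons_lift.
by rewrite fcons0 wE.
Qed.

(** The induction varies [m]: the operator-valued derivative of [frechet m f] is the curried
    [frechet m.+1 f], and currying does not increase norms. *)
Lemma frechet_bounded_derivs N f a : smooth_on N f ->
  (forall n x, (0 < n)%N -> N x -> `|frechet n f x| <= a n) ->
  forall n m, bounded_derivs N n (frechet m f) (fun k => a (m + k)%N).
Proof.
move=> sf fa; elim=> [//|n IH] m.
exists (@curry1 R X Y m \o frechet m.+1 f); split=> [x Nx|x Nx|].
- exact: is_diff_frechet (sf _ _ Nx).
- have [_ /(_ (frechet m.+1 f x))/le_trans] := @curry1_contraction R X Y m.
  by apply; rewrite addn1 fa.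
- apply: bounded_derivs_post; first exact: curry1_contraction.
  apply: bounded_derivs_le (IH m.+1) => k _; by rewrite addSnnS.
Qed.

Lemma smooth_bounded_derivs N f a n : smooth_on N f ->
  (forall n x, (0 < n)%N -> N x -> `|frechet n f x| <= a n) ->
  bounded_derivs N n f a.
Proof.
move=> sf fa; have := frechet_bounded_derivs sf fa n 0.
by move=> /(bounded_derivs_post eval_bmlin0_contraction).
Qed.

(** Each of the first [m] orders is turned into one step of [frechet] by uncurrying. The resulting
    identity holds only on [N], and openness of [N] makes it compatible with differentiation. *)
Lemma bounded_derivs_frechet N f a n m : open N ->
  bounded_derivs N (m + n) f a ->
  bounded_derivs N n (frechet m f) (fun k => a (m + k)%N).
Proof.
move=> oN; elim: m n => [|m IH] n df.
  exact: bounded_derivs_post bmlin0_contraction df.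
have [f' [ff' f'a df']] : bounded_derivs N n.+1 (frechet m f) (fun k => a (m + k)%N).
  by apply: IH; rewrite -addSnnS.
apply: (@bounded_derivs_eq _ _ _ _ _ (@uncurry1 R X Y m \o f')) => //.
  by move=> x Nx; rewrite (frechetS_app1 (ff' x Nx)).
apply: bounded_derivs_post; first exact: uncurry1_contraction.
by apply: bounded_derivs_le df' => k _; rewrite addSnnS.
Qed.

Lemma bounded_derivs_smooth N f a : open N ->
  (forall n, bounded_derivs N n f a) -> smooth_on N f.
Proof.
move=> oN df n x Nx.
(* One order beyond [n] is spent on the differentiability of [frechet n f] itself. *)
by have [f' [/(_ _ Nx)[]]] := bounded_derivs_frechet (n := 1) oN (df (n + 1)%N).
Qed.

Lemma norm_frechet_le N f a n x : open N -> N x -> (0 < n)%N ->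
  bounded_derivs N n f a -> `|frechet n f x| <= a n.
Proof.
move=> oN Nx; case: n => // n _; rewrite -addn1 => df.
have [f' [ff' f'a _]] := bounded_derivs_frechet oN df.
move: (f'a x Nx); rewrite addn1 (frechetS_app1 (ff' x Nx)).
by apply: le_trans; have [_ /(_ (f' x))] := @uncurry1_contraction R X Y n.
Qed.

End FrechetBoundedDerivs.

(** * Counting compositions of [n] into [m] positive parts *)

Definition compn (n m : nat) : nat :=
  match n, m with
  | 0, 0 => 1
  | n'.+1, m'.+1 => 'C(n', m')
  | _, _ => 0
  end.

(** Since [compn n m] is the coefficient of t^n in (t/(1-t))^m, partial sums are coefficients of
    t^m/(1-t)^(m+1). *)
Lemma sum_compn n m : (\sum_(j < n.+1) compn j m = 'C(n, m))%N.
Proof.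
elim: n m => [|n IH] m; first by rewrite big_ord1; case: m.
by rewrite big_ord_recr /= IH; case: m => [|m]; rewrite ?bin0 // binS addnC.
Qed.

(** The weights are the coefficients of t/(1-t)^2, so the sum is the coefficient of t^(n+1) in
    t^(m+1)/(1-t)^(m+2). The induction obtains it by summing [sum_compn] once more. *)
Lemma wsum_compn n m :
  (\sum_(j < n.+1) (n.+1 - j) * compn j m = 'C(n.+1, m.+1))%N.
Proof.
elim: n => [|n IH]; first by rewrite big_ord1; case: m.
rewrite binS -IH -(sum_compn n.+1).
under eq_bigr => j _ do rewrite subSn -1?ltnS// mulSn addnC.
by rewrite big_split /= big_ord_recr /= subnn mul0n addn0.
Qed.

Lemma compn0 n m : (n < m)%N -> compn n m = 0%N.
Proof. by case: n m => [|n] [|m] //= nm; rewrite bin_small. Qed.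

Lemma lconvE {R : realType} (a b : nat -> R) k :
  lconv a b k = \sum_(j < k.+1) 'C(k, j)%:R * a j * b (k - j)%N.
Proof.
elim: k a b => [|k IH] a b; first by rewrite big_ord1 bin0 mul1r.
rewrite /= !IH [RHS]big_ord_recl /= bin0 mul1r subn0.
under [X in _ = _ + X]eq_bigr => i _.
  rewrite binS natrD !mulrDl subSS; over.
rewrite big_split /= addrA [RHS]addrC; congr (_ + _).
rewrite [in LHS]big_ord_recl /= bin0 mul1r subn0; congr (_ + _).
rewrite [RHS]big_ord_recr /= bin_small// !mul0r addr0.
by apply: eq_bigr => i _; rewrite subnSK.
Qed.

(** * Factorial weights and the explicit majorant of a composition *)

Section Gevrey.
Variables (R : realType) (s mu nu : R).
Hypotheses (s1 : 1 <= s) (mu0 : 0 <= mu) (nu0 : 0 <= nu).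

Let F (k : nat) : R := k`!%:R `^ s.

Let F_gt0 k : 0 < F k.
Proof. by rewrite powR_gt0// ltr0n fact_gt0. Qed.

(** With p = C(n+1, j), expanding [F n.+1] and [F m.+1] reduces the claim to p (m+1)^s <= p^s (m+1).
    This follows from s >= 1 and m+1 <= j+1 = C(j+1, j) <= p. For s = 1 both sides agree. *)
Let F_prod n j m : (m <= j <= n)%N ->
  'C(n, j)%:R * F j * F (n.+1 - j) * F m.+1 * n.+1%:R <=
  F n.+1 * F m * m.+1%:R * (n.+1 - j)%:R.
Proof.
move=> /andP[mj jn]; set p := 'C(n.+1, j).
have p0 : (0 < p%:R :> R) by rewrite ltr0n bin_gt0 (leq_trans jn).
have mp : (m.+1%:R <= p%:R :> R).
  rewrite ler_nat (@leq_trans j.+1)// -{1}(binSn j) leq_bin2l//.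
have FE : F n.+1 = p%:R `^ s * F j * F (n.+1 - j).
  by rewrite /F -!powRM ?mulr_ge0// -!natrM -mulnA bin_fact// (leq_trans jn).
have FmE : F m.+1 = m.+1%:R `^ s * F m by rewrite /F -powRM// -natrM factS.
have pE : 'C(n, j)%:R * n.+1%:R = p%:R * (n.+1 - j)%:R :> R.
  rewrite -!natrM; congr (_%:R).
  by rewrite mulnC [RHS]mulnC mul_bin_down.
have xs : p%:R * m.+1%:R `^ s <= p%:R `^ s * m.+1%:R.
  pose x : R := m.+1%:R / p%:R.
  have xp : m.+1%:R = x * p%:R by rewrite divfK// gt_eqF.
  have x01 : 0 < x <= 1 by rewrite divr_gt0//= ler_pdivrMr// mul1r.
  have -> : m.+1%:R `^ s = x `^ s * p%:R `^ s.
    by rewrite xp powRM ?ltW//; case/andP: x01.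
  rewrite xp [leRHS](_ : _ = p%:R * (x * p%:R `^ s)); last by ring.
  by rewrite ler_wpM2l ?ler_wpM2r ?powR_ge0 ?ge1r_powR// ltW.
rewrite FE FmE.
have -> : 'C(n, j)%:R * F j * F (n.+1 - j) * (m.+1%:R `^ s * F m) * n.+1%:R =
  (p%:R * m.+1%:R `^ s) * (F j * F (n.+1 - j) * F m * (n.+1 - j)%:R).
  transitivity (('C(n, j)%:R * n.+1%:R) * F j * F (n.+1 - j) * (m.+1%:R `^ s * F m)).
    by ring.
  by rewrite pE; ring.
have -> : p%:R `^ s * F j * F (n.+1 - j) * F m * m.+1%:R * (n.+1 - j)%:R =
  (p%:R `^ s * m.+1%:R) * (F j * F (n.+1 - j) * F m * (n.+1 - j)%:R) by ring.
by rewrite ler_wpM2r// !mulr_ge0// ltW.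
Qed.

(* comp_coef n m bounds the sum, over the partitions of n elements into m
   blocks, of the products of the bounds of the derivatives of the inner map
   whose orders are the block sizes. *)
Definition comp_coef (n m : nat) : R :=
  F n / F m * (compn n m)%:R * mu ^+ m * nu ^+ n.

Lemma comp_coef0 n m : (n < m)%N -> comp_coef n m = 0.
Proof. by move=> nm; rewrite /comp_coef compn0// mulr0 !mul0r. Qed.

Lemma comp_coefS0 n : comp_coef n.+1 0 = 0.
Proof. by rewrite /comp_coef mulr0 !mul0r. Qed.

(** Recursion for set partitions by the block of a distinguished element among n+1: it has n+1-j
    elements, and the other j elements form m blocks. It is an equality for s = 1. *)
Lemma comp_coefS n m :
  \sum_(j < n.+1) 'C(n, j)%:R * comp_coef j m *
     (F (n - j).+1 * mu * nu ^+ (n - j).+1) <= comp_coef n.+1 m.+1.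
Proof.
have sumE : \sum_(j < n.+1) (n.+1 - j)%:R * (compn j m)%:R =
    n.+1%:R * 'C(n, m)%:R / m.+1%:R :> R.
  apply: (canRL (mulfK _)); first by rewrite pnatr_eq0.
  under eq_bigr => j _ do rewrite -natrM.
  by rewrite -natr_sum wsum_compn -!natrM mulnC -mul_bin_diag.
(* The right-hand side is distributed over j in proportion to [(n.+1 - j) * compn j m], so that
   [F_prod] compares the sums term by term. *)
have -> : comp_coef n.+1 m.+1 = \sum_(j < n.+1)
    F n.+1 / F m.+1 * (m.+1%:R / n.+1%:R) * mu ^+ m.+1 * nu ^+ n.+1 *
      ((n.+1 - j)%:R * (compn j m)%:R).
  rewrite -mulr_sumr sumE /comp_coef /=.
  have := F_gt0 m.+1; move: (F m.+1) => x x0.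
  by field; rewrite !nat1r !pnatr_eq0 (gt_eqF x0).
apply: ler_sum => j _.
have [jm|mj] := ltnP j m.
  by rewrite comp_coef0// compn0// !(mulr0, mul0r).
have jn : (j <= n)%N by rewrite -ltnS.
rewrite /comp_coef -subSn//.
have -> : nu ^+ n.+1 = nu ^+ j * nu ^+ (n.+1 - j).
  by rewrite -exprD subnKC// ltnW.
have Fm := F_gt0 m; have Fm1 := F_gt0 m.+1.
have -> : F n.+1 / F m.+1 * (m.+1%:R / n.+1%:R) * mu ^+ m.+1 *
    (nu ^+ j * nu ^+ (n.+1 - j)) * ((n.+1 - j)%:R * (compn j m)%:R) =
  (F n.+1 * F m * m.+1%:R * (n.+1 - j)%:R) *
  ((compn j m)%:R * mu ^+ m.+1 * nu ^+ j * nu ^+ (n.+1 - j) /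
   (F m * F m.+1 * n.+1%:R)).
  by field; rewrite !nat1r !pnatr_eq0 (gt_eqF Fm) (gt_eqF Fm1).
have -> : 'C(n, j)%:R * (F j / F m * (compn j m)%:R * mu ^+ m * nu ^+ j) *
    (F (n.+1 - j)%N * mu * nu ^+ (n.+1 - j)) =
  ('C(n, j)%:R * F j * F (n.+1 - j) * F m.+1 * n.+1%:R) *
  ((compn j m)%:R * mu ^+ m.+1 * nu ^+ j * nu ^+ (n.+1 - j) /
   (F m * F m.+1 * n.+1%:R)).
  by rewrite exprS; field; rewrite !nat1r !pnatr_eq0 (gt_eqF Fm) (gt_eqF Fm1).
rewrite ler_wpM2r//; last by apply: F_prod; rewrite mj.
by rewrite divr_ge0 ?mulr_ge0 ?exprn_ge0// ltW.
Qed.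

(** The Faà di Bruno sum over the number m of blocks: if [b] bounds the derivatives of g, this
    bounds the k-th derivative of D^i g \o f. *)
Definition comp_bound (b : nat -> R) i k : R :=
  \sum_(m < k.+1) comp_coef k m * b (i + m)%N.

Lemma comp_bound0 b i : comp_bound b i 0%N = b i.
Proof.
by rewrite /comp_bound big_ord1 /comp_coef divff ?gt_eqF// !mulr1 mul1r addn0.
Qed.

Lemma comp_boundS b i k : (forall j, 0 <= b j) ->
  lconv (comp_bound b i.+1)
    (fun j => F j.+1 * mu * nu ^+ j.+1) k <= comp_bound b i k.+1.
Proof.
move=> b0; rewrite lconvE /comp_bound [leRHS]big_ord_recl /=.
rewrite comp_coefS0 mul0r add0r.
apply: (@le_trans _ _ (\sum_(m < k.+1) \sum_(j < k.+1) 'C(k, j)%:R *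
   comp_coef j m * (F (k - j).+1 * mu * nu ^+ (k - j).+1) * b (i + m.+1)%N)).
  rewrite exchange_big /= le_eqVlt; apply/orP; left; apply/eqP.
  apply: eq_bigr => j _.
  (* The range of m is made independent of j; the added terms vanish since [comp_coef j m] is 0 for
     j < m. *)
  rewrite (big_ord_widen k.+1 (fun m => comp_coef j m * b (i.+1 + m)%N))//.
  rewrite big_mkcond /= mulr_sumr mulr_suml.
  apply: eq_bigr => m _; case: ltnP => jm; last first.
    by rewrite comp_coef0// !(mulr0, mul0r).
  by rewrite addSnnS; ring.
apply: ler_sum => m _; rewrite -mulr_suml /= ler_wpM2r//.
exact: comp_coefS.
Qed.

(** The weights [F m] cancel. With q = nu' mu, the binomial theorem leaves q (q+1)^n = (q/(q+1))
    (q+1)^(n+1), the source of the constants of the composition. *)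
Lemma comp_bound_gevrey mu' nu' n : 0 <= mu' -> 0 <= nu' ->
  comp_bound (fun k => F k * mu' * nu' ^+ k) 0 n.+1 =
  F n.+1 * (mu' * ((nu' * mu) / (nu' * mu + 1))) *
    ((nu' * mu + 1) * nu) ^+ n.+1.
Proof.
move=> mu'0 nu'0.
have d0 : nu' * mu + 1 != 0 by rewrite gt_eqF// ltr_wpDl// mulr_ge0.
transitivity (F n.+1 * mu' * nu ^+ n.+1 *
    (\sum_(m < n.+1) (nu' * mu) ^+ m *+ 'C(n, m)) * (nu' * mu)).
  rewrite /comp_bound big_ord_recl comp_coefS0 mul0r add0r.
  rewrite mulr_sumr mulr_suml; apply: eq_bigr => i _.
  rewrite /comp_coef /= add0n /bump /= add1n -mulr_natr exprMn exprS [nu' ^+ _]exprS.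
  have := F_gt0 i.+1; move: (F i.+1) => x x0.
  by field; rewrite gt_eqF.
have -> : \sum_(m < n.+1) (nu' * mu) ^+ m *+ 'C(n, m) = (nu' * mu + 1) ^+ n.
  rewrite addrC exprDn; apply: eq_bigr => i _; by rewrite expr1n mul1r.
rewrite [in RHS]exprMn [(nu' * mu + 1) ^+ n.+1]exprS.
by field.
Qed.

End Gevrey.

(** * Gevrey bounds as majorants, and the composition theorem *)

Section GevreyDerivatives.
Context {R : realType} {X Y : normedModType R}.
Implicit Types (U N : set X) (f : X -> Y) (s t mu nu : R).

Lemma gevrey_with_bounded_derivs U f s t x N mu nu n : s <= t ->
  gevrey_with U f s x N mu nu ->
  bounded_derivs N n f (fun k => k`!%:R `^ t * mu * nu ^+ k).
Proof.
move=> st [_ _ _ sf [mu0 nu0 fb]].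
apply: smooth_bounded_derivs sf _ => {}n {}x n0 Nx.
rewrite -lee_fin (le_trans _ (le_trans (fb n n0) _))//.
  by apply: ereal_sup_ubound; exists x.
(* The exponent may grow from [s] to [t] because k! >= 1; this gives both maps a common exponent. *)
rewrite lee_fin -!mulrA ler_wpM2r ?mulr_ge0 ?exprn_ge0//.
by rewrite ler_powR// ler1n fact_gt0.
Qed.

Lemma bounded_derivs_gevrey_with U f s x N mu nu a : open N -> N `<=` U -> N x ->
  0 <= mu -> 0 <= nu ->
  (forall k, (0 < k)%N -> a k <= k`!%:R `^ s * mu * nu ^+ k) ->
  (forall n, bounded_derivs N n f a) ->
  gevrey_with U f s x N mu nu.
Proof.
move=> oN NU Nx mu0 nu0 amunu df; split=> //.
  exact: bounded_derivs_smooth oN df.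
split=> // n n0; apply: ge_ereal_sup => _ [y Ny <-].
by rewrite lee_fin (le_trans _ (amunu n n0))// (norm_frechet_le oN Ny n0 (df n)).
Qed.

End GevreyDerivatives.

Theorem theorem7 (R : realType) (E1 E2 E3 : completeNormedModType R)
    (X1 : set E1) (X2 : set E2) (M1 : E1 -> E2) (M2 : E2 -> E3)
    (x1 : E1) (s1 s2 : R)
    (N1 : set E1) (mu1 nu1 : R) (N2 : set E2) (mu2 nu2 : R)
    (oX1 : open X1) (oX2 : open X2) (M1X : M1 @` X1 `<=` X2) (Xx1 : X1 x1)
    (s1_ge1 : 1 <= s1) (s2_ge1 : 1 <= s2)
    (G1 : gevrey_with X1 M1 s1 x1 N1 mu1 nu1)
    (G2 : gevrey_with X2 M2 s2 (M1 x1) N2 mu2 nu2) :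
  let s := Num.max s1 s2 in
  let M := M2 \o M1 in
  let N := N1 `&` M1 @^-1` N2 in
  let mu := mu2 * ((nu2 * mu1) / (nu2 * mu1 + 1)) in
  let nu := (nu2 * mu1 + 1) * nu1 in
  gevrey_at X1 M s x1 /\ gevrey_with X1 M s x1 N mu nu.

Proof.
move=> s M N mu nu.
have [oN1 N1X1 N1x1 sM1 [mu1_ge0 nu1_ge0 _]] := G1.
have [oN2 N2X2 N2x2 sM2 [mu2_ge0 nu2_ge0 _]] := G2.
have s1s : s1 <= s by rewrite le_max lexx.
have s2s : s2 <= s by rewrite le_max lexx orbT.
have s_ge1 : 1 <= s := le_trans s1_ge1 s1s.
have cM1 x : N1 x -> {for x, continuous M1}.
  (* Order 1 already yields differentiability, hence continuity, of [M1] at the points of [N1]; this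
     makes [N] open. *)
  move=> Nx; have [f' [ff' _ _]] := gevrey_with_bounded_derivs 1 (lexx s1) G1.
  by have [dM1 _] := ff' x Nx; exact: differentiable_continuous.
have oN : open N.
  rewrite openE => x [N1x N2x]; apply: filterI; first exact: open_nbhs_nbhs.
  by apply: (cM1 x N1x); exact: open_nbhs_nbhs.
have alpha_ge0 : 0 <= nu2 * mu1 by rewrite mulr_ge0.
suff G : gevrey_with X1 M s x1 N mu nu by split=> //; exists N, mu, nu.
pose b k := k`!%:R `^ s * mu2 * nu2 ^+ k.
apply: (bounded_derivs_gevrey_with (a := comp_bound s mu1 nu1 b 0)) => //.
- by move=> x [/N1X1].
- by rewrite /mu mulr_ge0// divr_ge0// addr_ge0.
- by rewrite /nu mulr_ge0// addr_ge0.
- by case=> // k _; rewrite comp_bound_gevrey.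
(* [comp_bound] solves the recursive inequalities on [C], with initial values [b]. *)
- move=> n; apply: (bounded_derivs_comp (N' := N2)
    (a := fun k => k`!%:R `^ s * mu1 * nu1 ^+ k)
    (C := fun i k => comp_bound s mu1 nu1 b i k)) (gevrey_with_bounded_derivs n s2s G2).
  + by move=> x [].
  + by move=> i; rewrite comp_bound0.
  + by move=> i k; apply: comp_boundS => // j; rewrite /b !mulr_ge0 ?exprn_ge0 ?powR_ge0.
  + apply: bounded_derivs_sub (gevrey_with_bounded_derivs n s1s G1).
    by move=> x [].
Qed.
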